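(* Let $G=(V,E)$ be a finite simple connected $4$-valent graph (every vertex has degree $4$), and let $\mathbf{p}:V\to\mathbb{R}^2$ be a configuration in general position, i.e. the images under $\mathbf{p}$ of any three points of $V$ do not lie on the same line. Then $$r(G(\mathbf{p}))\geq \frac{8}{5}|V|-1.$$
   Context: All graphs are finite and simple. For a graph $G=(V,E)$ and a map $\mathbf{p}:V\to\mathbb{R}^2$ (a planar realization, or configuration), the rigidity matrix $R(\mathbf{p})$ is the $|E|\times 2|V|$ real matrix whose row indexed by an edge $e_{ij}$ joining $v_i$ and $v_j$ has $\mathbf{p}(v_i)-\mathbf{p}(v_j)$ in the two columns belonging to $v_i$, $\mathbf{p}(v_j)-\mathbf{p}(v_i)$ in the two columns belonging to $v_j$, and $0$ elsewhere. Its rank is denoted $r(G(\mathbf{p}))$. *)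

(* Defs.v *)
From mathcomp Require Import all_boot all_order all_algebra.
From mathcomp Require Import reals.

Set Implicit Arguments.
Unset Strict Implicit.
Unset Printing Implicit Defensive.

Import GRing.Theory Num.Theory.
Local Open Scope ring_scope.

(* A simple graph on V is a symmetric irreflexive relation; its edges are
   the unordered pairs of adjacent vertices. *)
Definition edges (V : finType) (adj : rel V) : {set {set V}} :=
  [set [set x; y] | x in V, y in V & adj x y].

Definition connected_graph (V : finType) (adj : rel V) : Prop :=
  forall x y : V, connect adj x y.

Definition valent (k : nat) (V : finType) (adj : rel V) : Prop :=
  forall x : V, #|[set y | adj x y]| = k.

(* The line of direction d through the point a. *)
Definition on_line (R : realType) (a d q : 'rV[R]_2) : Prop :=
  exists t : R, q = a + t *: d.

Definition collinear3 (R : realType) (q1 q2 q3 : 'rV[R]_2) : Prop :=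
  exists a d : 'rV[R]_2,
    [/\ d != 0, on_line a d q1, on_line a d q2 & on_line a d q3].

Definition general_position (R : realType) (V : finType)
    (p : V -> 'rV[R]_2) : Prop :=
  forall x y z : V, x != y -> y != z -> x != z ->
    ~ collinear3 (p x) (p y) (p z).

(* Rows are indexed by the edges and columns by the pairs (vertex,
   coordinate), so there are 2 * #|V| columns.  When v is an endpoint of the
   edge E, the set E :\ v contains exactly the other endpoint, so the sum
   below has a single term. *)
Definition rigidity_mx (R : realType) (V : finType) (adj : rel V)
    (p : V -> 'rV[R]_2) : 'M[R]_(#|edges adj|, #|{: V * 'I_2}|) :=
  \matrix_(i, j)
    let E : {set V} := enum_val i in
    let: (v, k) := enum_val j in
    if v \in E then \sum_(w in E :\ v) (p v - p w) 0 k else 0.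

(* Main.v *)
Require Import Defs.
From mathcomp Require Import all_boot all_order all_algebra.
From mathcomp Require Import ring lra zify.
From mathcomp Require Import reals.

Import GRing.Theory Num.Theory.
Local Open Scope ring_scope.

(** The graph has 2n edges (n the number of vertices), so the rank is 2n minus
    the dimension of the space of self-stresses, the vectors of the left kernel
    of the rigidity matrix.  It suffices to find at most 2n/5 + 1 edges such
    that a stress vanishing on all of them is zero ([rank_rigidity_mx],
    [determined_all]).

    Two facts bring general position in.  If at most two edges between a vertex
    set X and its complement carry stress, then none does
    ([stress_small_cut]): the moments of the cut forces about any point sum to
    zero, and about a suitable endpoint of one of the two edges the other one
    is the only force with a moment.  Hence an edge cut of size at most 2
    splits the problem at no cost ([determined_split]), and a vertex of degree
    d >= 2 can be deleted at the cost of d - 2 edges ([determined_vertex]).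

    The rest is counting.  Write e(A,B) for the number of adjacent pairs in
    A x B.  Call a set W of at least two vertices 3-edge-connected if every cut
    of the graph induced on W has at least three edges.  The central claim is
    that, if W is also joined to its complement, then some k edges determine
    all stresses supported in W with
            10 k + 8 |W| <= 3 e(W,W) + 6            ([sparse_bound]).
    It goes by induction on |W|.  Delete a vertex v that has degree 3 in W, at
    cost 1, and split the rest along cuts of size at most 2 until all pieces
    are single vertices or 3-edge-connected.  Every piece U satisfies
    e(U, W - U) >= 3 because W is 3-edge-connected, which turns the bound for U
    into 10 k + 8 |U| + 3 <= 3 e(U,W); a single vertex gives the same with 1 in
    place of 3.  The leading terms are additive over the pieces, and W - v has
    either a large piece or at least three single ones, so that
    10 k + 8 |W - v| + 3 <= 3 e(W - v, W) ([determined_proper]).  Adding v back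
    gives exactly the claim for W.

    In the whole graph every cut is even ([cut_even]).  If some cut has size 2,
    the two sides are treated as above with cuts of size at least 2 and need at
    most 2n/5 edges in total; if not, all cuts have size at least 4, and
    deleting one vertex at cost 2 leads to 2n/5 + 1. *)

(** * Counting adjacent pairs *)

Section EdgeCounts.
Set Implicit Arguments.
Unset Strict Implicit.
Context {V : finType} (adj : rel V).

(** Edges inside the intersection of A and B are counted twice. *)
Definition edge_count (A B : {set V}) : nat :=
  (\sum_(x in A) \sum_(y in B) adj x y)%N.

Lemma edge_count_card A B :
  edge_count A B = #|[set q : V * V | [&& q.1 \in A, q.2 \in B & adj q.1 q.2]]|.
Proof.
rewrite /edge_count -sum1dep_card pair_big /=.
rewrite [RHS](eq_bigl (fun q : V * V => ((q.1 \in A) && (q.2 \in B)) && adj q.1 q.2)).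
  by rewrite [RHS]big_mkcondr /=; apply: eq_bigr => q _; case: (adj _ _).
by move=> q; rewrite andbA.
Qed.

Lemma edge_countUl (A B C : {set V}) : [disjoint A & B] ->
  edge_count (A :|: B) C = (edge_count A C + edge_count B C)%N.
Proof.
by move=> dAB; rewrite -bigU //=; apply: eq_bigl => x; rewrite inE.
Qed.

Lemma setUDK_sub (A B : {set V}) : A \subset B -> A :|: (B :\: A) = B.
Proof. by move=> AB; rewrite -{1}(setIidPr AB) setID. Qed.

Lemma disjointD (A B : {set V}) : [disjoint A & B :\: A].
Proof. by rewrite -setI_eq0 setIDA setDIl setDv set0I. Qed.

Hypothesis adj_sym : symmetric adj.

Lemma edge_countC (A B : {set V}) : edge_count A B = edge_count B A.
Proof.
rewrite /edge_count exchange_big.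
by apply: eq_bigr => x _; apply: eq_bigr => y _; rewrite adj_sym.
Qed.

Lemma edge_countUr (A B C : {set V}) : [disjoint B & C] ->
  edge_count A (B :|: C) = (edge_count A B + edge_count A C)%N.
Proof. by move=> dBC; rewrite edge_countC edge_countUl // !(edge_countC A). Qed.

Lemma edge_count_splitr (U W C : {set V}) : U \subset W ->
  edge_count C W = (edge_count C U + edge_count C (W :\: U))%N.
Proof. by move=> UW; rewrite -edge_countUr ?disjointD // setUDK_sub. Qed.

Lemma edge_count_subr (A B C : {set V}) : B \subset C ->
  (edge_count A B <= edge_count A C)%N.
Proof. by move=> BC; rewrite (edge_count_splitr _ BC) leq_addr. Qed.

Hypothesis adj_irr : irreflexive adj.

Lemma edge_count1 x : edge_count [set x] [set x] = 0%N.
Proof. by rewrite /edge_count !big_set1 adj_irr. Qed.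

Lemma edge_count_even A : ~~ odd (edge_count A A).
Proof.
have [n] := ubnP #|A|; elim: n A => // n IH A An.
have [->|[x xA]] := set_0Vmem A; first by rewrite /edge_count big_set0.
have dx : [disjoint [set x] & A :\ x] by rewrite disjoints1 !inE eqxx.
rewrite -(setD1K xA) edge_countUl // !edge_countUr // edge_count1.
rewrite (edge_countC _ [set x]) add0n addnA addnn oddD odd_double /=.
by apply: IH; move: An; rewrite (cardsD1 x A) xA.
Qed.

Hypothesis adj_4 : valent 4 adj.

Lemma edge_count_all A : edge_count A [set: V] = (4 * #|A|)%N.
Proof.
rewrite mulnC -sum_nat_const; apply: eq_bigr => x _.
rewrite -(adj_4 x) -sum1dep_card [RHS]big_mkcond.
by apply: eq_big => [y|y _]; rewrite ?inE //; case: (adj x y).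
Qed.

(** The degrees in A sum to 4 |A|, and the edges inside A contribute an even
    number to this sum. *)
Lemma cut_even A : ~~ odd (edge_count A (~: A)).
Proof.
have := edge_count_all A; rewrite (edge_count_splitr A (subsetT A)) setTD.
by move/(congr1 odd); rewrite oddD (negPf (edge_count_even A)) oddM /= => ->.
Qed.

(** Connectedness gives one edge, and the parity of the cut a second one. *)
Lemma cut_ge2 A : connected_graph adj -> A != set0 -> ~: A != set0 ->
  (1 < edge_count A (~: A))%N.
Proof.
move=> adj_conn /set0Pn[x xA] /set0Pn[y yA].
suff : edge_count A (~: A) != 0%N by have := cut_even A; case: edge_count => [|[]].
apply/negP => /eqP/eqP; rewrite sum_nat_eq0 => /forallP cut0.
have closedA : closed adj (mem A).
  apply: (intro_closed (sym_connect_sym adj_sym)) => u v uv uA /=.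
  have := cut0 u; rewrite uA sum_nat_eq0 => /forallP/(_ v).
  by rewrite inE uv; case: (v \in A).
have := closed_connect closedA (adj_conn x y).
by rewrite /= xA; move: yA; rewrite inE => /negPf->.
Qed.

Lemma mem_edges x y : adj x y -> [set x; y] \in edges adj.
Proof. by move=> xy; apply/imset2P; exists x y; rewrite ?inE. Qed.

Lemma edgesP E : E \in edges adj -> exists x y, adj x y /\ E = [set x; y].
Proof. by case/imset2P => x y _; rewrite inE => /andP[_ xy] ->; exists x, y. Qed.

(** An edge is the image of at most two ordered pairs, and there are 4 |V|
    ordered adjacent pairs. *)
Lemma card_edges : (2 * #|V| <= #|edges adj|)%N.
Proof.
have adj_pairs : #|[set q : V * V | adj q.1 q.2]| = (4 * #|V|)%N.
  rewrite -cardsT -edge_count_all edge_count_card.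
  by apply: eq_card => q; rewrite !inE.
suff : (#|[set q : V * V | adj q.1 q.2]| <= 2 * #|edges adj|)%N by lia.
rewrite -sum1_card (partition_big (fun q => [set q.1; q.2]) (mem (edges adj))) /=.
  rewrite mulnC -sum_nat_const; apply: leq_sum => E /edgesP[x [y [xy ->]]].
  rewrite sum1_card; apply: leq_trans (_ : #|[set (x, y); (y, x)]| <= _)%N; last first.
    by rewrite cards2; case: (_ != _).
  apply/subset_leq_card/subsetP => -[a b]; rewrite unfold_in /= !inE /= => /andP[ab /eqP e].
  have abN : a != b by apply: contraTneq ab => ->; rewrite adj_irr.
  have : a \in [set x; y] by rewrite -e !inE eqxx.
  have : b \in [set x; y] by rewrite -e !inE eqxx orbT.
  rewrite !inE !xpair_eqE => /orP[]/eqP bE /orP[]/eqP aE; move: abN;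
    by rewrite aE bE ?eqxx ?orbT.
by move=> q; rewrite inE; exact: mem_edges.
Qed.

End EdgeCounts.

(** * Stresses and small edge cuts *)

Section Stresses.
Set Implicit Arguments.
Unset Strict Implicit.
Context {R : realType}.

(** The moment about the origin of the force v acting at u. *)
Definition cross (u v : 'rV[R]_2) : R := u 0 0 * v 0 1 - u 0 1 * v 0 0.

Lemma row2P (u v : 'rV[R]_2) : u 0 0 = v 0 0 -> u 0 1 = v 0 1 -> u = v.
Proof.
move=> h0 h1; apply/rowP => -[[|[|k]] hk] //.
  by rewrite (_ : Ordinal hk = 0) //; apply: val_inj.
by rewrite (_ : Ordinal hk = 1) //; apply: val_inj.
Qed.

Lemma cross_eq0_scale (u v : 'rV[R]_2) :
  cross u v = 0 -> u != 0 -> exists t, v = t *: u.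
Proof.
rewrite /cross => cr0 un0.
have [u0|u0] := eqVneq (u 0 0) 0; last first.
  exists (v 0 0 / u 0 0); apply: row2P; rewrite !mxE; first by field.
  by apply: (mulfI u0); rewrite (_ : _ * v 0 1 = u 0 1 * v 0 0); [field | lra].
have [u1|u1] := eqVneq (u 0 1) 0.
  by case/eqP: un0; apply: row2P; rewrite !mxE.
exists (v 0 1 / u 0 1); apply: row2P; rewrite !mxE ?u0 ?mulr0; last by field.
by move: cr0; rewrite u0 mul0r sub0r => /eqP; rewrite oppr_eq0 mulf_eq0 (negPf u1) => /eqP.
Qed.

Context {V : finType} (adj : rel V) (p : V -> 'rV[R]_2).

Lemma general_position_cross (x y z : V) :
  general_position p -> x != y -> y != z -> x != z ->
  cross (p x - p z) (p y - p z) != 0.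
Proof.
move=> gen xy yz xz; apply/negP => /eqP cr0; apply: (gen x y z xy yz xz).
have on_start (a d : 'rV[R]_2) : on_line a d a by exists 0; rewrite scale0r addr0.
have on_end (a b : 'rV[R]_2) : on_line a (b - a) b.
  by exists 1; rewrite scale1r addrC subrK.
case: (eqVneq (p x) (p z)) => [pxz | pxz].
  case: (eqVneq (p y) (p z)) => [pyz | pyz].
    exists (p z), (const_mx 1); rewrite pxz pyz; split=> //.
    by apply/eqP => /rowP /(_ 0); rewrite !mxE => /eqP; rewrite oner_eq0.
  by exists (p z), (p y - p z); rewrite pxz; split=> //; rewrite subr_eq0.
have [|t py] := cross_eq0_scale cr0; first by rewrite subr_eq0.
exists (p z), (p x - p z); split=> //; first by rewrite subr_eq0.
by exists t; rewrite -py addrC subrK.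
Qed.

(** A vector in the left kernel of the rigidity matrix, written as a symmetric
    function on pairs of vertices; this avoids indices of edges and lets a
    stress be restricted to an induced subgraph. *)
Definition stress (w : V -> V -> R) : Prop :=
  [/\ forall x y, w x y = w y x,
      forall x y, ~~ adj x y -> w x y = 0
    & forall x k, \sum_y w x y * (p x 0 k - p y 0 k) = 0].

(** All forces at x pass through p x, so their total moment about q is the
    moment of their resultant, which is zero. *)
Lemma stress_moment w q x : stress w ->
  \sum_y w x y * cross (p x - q) (p y - q) = 0.
Proof.
case=> _ _ eqw; pose c k := p x 0 k - q 0 k.
transitivity (c 1 * (\sum_y w x y * (p x 0 0 - p y 0 0))
              - c 0 * (\sum_y w x y * (p x 0 1 - p y 0 1))).
  rewrite !mulr_sumr -sumrB; apply: eq_bigr => y _.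
  by rewrite /cross /c !mxE; ring.
by rewrite !eqw !mulr0 subr0.
Qed.

(** In the sum of the moments at the vertices of X, an edge inside X
    contributes twice with opposite signs; only the cut edges remain. *)
Lemma stress_cut_moment w q (X : {set V}) : stress w ->
  \sum_(x in X) \sum_(y in ~: X) w x y * cross (p x - q) (p y - q) = 0.
Proof.
move=> sw; pose m x y := w x y * cross (p x - q) (p y - q).
have anti x y : m x y = - m y x.
  by rewrite /m /cross; case: sw => /(_ x y) -> _ _; ring.
have inner : \sum_(x in X) \sum_(y in X) m x y = 0.
  set S := LHS; suff : S = - S by lra.
  rewrite {2}/S exchange_big -sumrN; apply: eq_bigr => x _.
  by rewrite -sumrN; apply: eq_bigr => y _; exact: anti.
have : \sum_(x in X) \sum_y m x y = 0.
  by apply: big1 => x _; exact: stress_moment.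
under eq_bigr => x _ do rewrite (bigID (mem X)) /=.
rewrite big_split /= inner add0r.
move=> e0; rewrite -[RHS]e0.
by apply: eq_bigr => x _; apply: eq_bigl => y; rewrite inE.
Qed.

(** To see that the cut edge xy carries no stress, choose a third vertex z
    lying on the other cut edge, if there is one.  About p z that edge has no
    moment, while the moment of xy is a nonzero multiple of its stress. *)
Lemma stress_small_cut w (X : {set V}) (A : {set V * V}) :
  general_position p -> (2 < #|V|)%N -> stress w -> (#|A| <= 2)%N ->
  (forall x y, x \in X -> y \notin X -> (x, y) \notin A -> w x y = 0) ->
  forall x y, x \in X -> y \notin X -> w x y = 0.
Proof.
move=> gen V3 sw A2 wA x y xX yX; case: (boolP ((x, y) \in A)) => xyA; last exact: wA.
have xy : x != y by apply: contraNneq yX => <-.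
(* z is an endpoint of every cut edge other than xy that may carry stress *)
have [z [zx zy zA]] : exists z, [/\ z != x, z != y &
    forall a b, a \in X -> b \notin X -> (a, b) \in A -> (a, b) != (x, y) ->
      (a == z) || (b == z)].
  case: (set_0Vmem (A :\ (x, y))) => [A0 | [[a b]]].
    have : (0 < #|~: [set x; y]|)%N by rewrite cardsCs setCK cards2 xy; lia.
    case/card_gt0P => z; rewrite !inE negb_or => /andP[zx zy].
    exists z; split=> // a b _ _ abA abN.
    by move/setP/(_ (a, b)): A0; rewrite !inE abA abN.
  rewrite 2!inE => /andP[abN abA].
  have uniqA c d : (c, d) \in A -> (c, d) != (x, y) -> (c, d) = (a, b).
    move=> cdA cdN; apply/eqP; apply: contraLR A2 => cd_ab; rewrite -ltnNge.
    rewrite (cardsD1 (x, y)) xyA (cardsD1 (a, b)) !inE abN abA.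
    by rewrite (cardsD1 (c, d)) !inE cd_ab cdN cdA.
  case: (boolP ((a \in X) && (b \notin X))) => [/andP[aX bX]|abX].
    have [ax|ax] := eqVneq a x.
      exists b; split.
      - by apply: contraNneq bX => ->.
      - by apply: contraNneq abN => ->; rewrite ax.
      - by move=> c d _ _ cdA cdN; case: (uniqA c d cdA cdN) => _ ->; rewrite eqxx orbT.
    exists a; split=> //; first by apply: contraNneq yX => <-.
    by move=> c d _ _ cdA cdN; case: (uniqA c d cdA cdN) => -> _; rewrite eqxx.
  have : (0 < #|~: [set x; y]|)%N by rewrite cardsCs setCK cards2 xy; lia.
  case/card_gt0P => z; rewrite !inE negb_or => /andP[zx zy].
  exists z; split=> // c d cX dX cdA cdN.
  by case: (uniqA c d cdA cdN) abX => <- <-; rewrite cX dX.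
have := stress_cut_moment (p z) X sw.
rewrite (bigD1 x) //= (bigD1 y) ?inE //= [X in _ + X + _]big1 ?addr0; last first.
  move=> b; rewrite inE => /andP[bX bNy].
  case: (boolP ((x, b) \in A)) => xbA; last by rewrite wA ?mul0r.
  have /orP[/eqP e|/eqP ->] : (x == z) || (b == z).
    by apply: zA => //; rewrite xpair_eqE eqxx.
  - by rewrite e eqxx in zx.
  by rewrite subrr /cross !mxE; ring.
rewrite [X in _ + X]big1 ?addr0; last first.
  move=> a /andP[aX ax]; apply: big1 => b; rewrite inE => bX.
  case: (boolP ((a, b) \in A)) => abA; last by rewrite wA ?mul0r.
  have /orP[/eqP ->|/eqP ->] : (a == z) || (b == z).
  - by apply: zA => //; rewrite xpair_eqE (negPf ax).
  - by rewrite subrr /cross !mxE; ring.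
  - by rewrite subrr /cross !mxE; ring.
move/eqP; rewrite mulf_eq0 (negPf (general_position_cross gen xy _ _)) 1?eq_sym //.
by rewrite orbF => /eqP.
Qed.

(** * Sets of edges that determine the stresses *)

Definition supported (W : {set V}) (w : V -> V -> R) :=
  forall x y, x \notin W -> w x y = 0.

(** The set F need not consist of edges: a nonadjacent pair imposes nothing,
    which spares a side condition. *)
Definition determined (W : {set V}) (k : nat) : Prop :=
  exists2 F : {set V * V}, (#|F| <= k)%N &
    forall w, stress w -> supported W w ->
      (forall x y, (x, y) \in F -> w x y = 0) -> forall x y, w x y = 0.

Hypothesis adj_irr : irreflexive adj.

Lemma stress_restrict w (X Y : {set V}) : stress w -> supported (X :|: Y) w ->
  (forall x y, x \in X -> y \notin X -> w x y = 0) ->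
  stress (fun x y => if (x \in X) && (y \in X) then w x y else 0).
Proof.
move=> [symw adjw eqw] supw cutw; split=> [x y|x y xy|x k].
- by rewrite andbC symw.
- by rewrite adjw // if_same.
case: (boolP (x \in X)) => [xX|_]; last by apply: big1 => y _; rewrite mul0r.
rewrite -[RHS](eqw x k); apply: eq_bigr => y _ /=.
by case: (boolP (y \in X)) => // yX; rewrite cutw.
Qed.

Lemma determined1 x : determined [set x] 0.
Proof.
exists set0; rewrite ?cards0 // => w [symw adjw _] supw _ a b.
have [/eqP ->|aX] := boolP (a == x); last by apply: supw; rewrite inE.
have [/eqP ->|bX] := boolP (b == x); first by rewrite adjw ?adj_irr.
by rewrite symw supw // inE.
Qed.

Hypothesis p_gen : general_position p.
Hypothesis V_gt2 : (2 < #|V|)%N.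

(** The stress vanishes on the cut, so it is the sum of its restrictions to the
    two sides, and these are stresses again. *)
Lemma determined_split (X Y : {set V}) i j : [disjoint X & Y] ->
  (edge_count adj X Y <= 2)%N -> determined X i -> determined Y j ->
  determined (X :|: Y) (i + j).
Proof.
move=> disXY cutXY [F Fi detX] [G Gj detY].
exists (F :|: G) => [|w sw supw FGw].
  by apply: leq_trans (leq_add Fi Gj); rewrite cardsU leq_subr.
have [symw adjw eqw] := sw.
have cutw x y : x \in X -> y \notin X -> w x y = 0.
  pose A := [set q : V * V | [&& q.1 \in X, q.2 \in Y & adj q.1 q.2]].
  apply: (@stress_small_cut _ _ A p_gen V_gt2 sw) (x) (y).
    by rewrite -edge_count_card.
  move=> a b aX bX; rewrite inE /= aX /= negb_and => /orP[bY|/adjw //].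
  by rewrite symw supw // inE negb_or bX.
have cutw' x y : x \in Y -> y \notin Y -> w x y = 0.
  move=> xY yY; have [yX|yX] := boolP (y \in X).
    by rewrite symw cutw // (disjointFl disXY xY).
  by rewrite symw supw // inE negb_or yX.
have zeroX x y : x \in X -> y \in X -> w x y = 0.
  move=> xX yX.
  have := detX _ (stress_restrict sw supw cutw) _ _ x y; rewrite /= xX yX; apply.
    by move=> a b /negPf ->.
  by move=> a b abF; case: ifP => // _; apply: FGw; rewrite inE abF.
have supw' : supported (Y :|: X) w by rewrite setUC.
have zeroY x y : x \in Y -> y \in Y -> w x y = 0.
  move=> xX yX.
  have := detY _ (stress_restrict sw supw' cutw') _ _ x y; rewrite /= xX yX; apply.
    by move=> a b /negPf ->.
  by move=> a b abF; case: ifP => // _; apply: FGw; rewrite inE abF orbT.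
move=> x y; have [xX|xX] := boolP (x \in X).
  by have [yX|yX] := boolP (y \in X); [exact: zeroX | exact: cutw].
have [xY|xY] := boolP (x \in Y).
  by have [yX|yX] := boolP (y \in Y); [exact: zeroY | exact: cutw'].
by rewrite supw // inE negb_or xX.
Qed.

(** Prescribing zero on all but two of the edges from v to W leaves a cut
    around v with at most two stressed edges. *)
Lemma determined_vertex (W : {set V}) v k c : v \in W ->
  (edge_count adj [set v] W <= c.+2)%N -> determined (W :\ v) k -> determined W (k + c).
Proof.
move=> vW degv [F Fk detW].
(* F is enlarged by all but two of the edges vy, y in N. *)
pose N := enum [set y in W | adj v y].
have sizeN : (size N <= c.+2)%N.
  apply: leq_trans degv; rewrite -cardE /edge_count big_set1 -sum1dep_card.
  by rewrite big_mkcondr /=; apply: leq_sum => y _; case: (adj v y).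
exists (F :|: [set (v, y) | y in drop 2 N]) => [|w sw supw Fw].
  rewrite cardsU; apply: leq_trans (leq_subr _ _) _; apply: leq_add => //.
  apply: leq_trans (leq_imset_card _ _) _; apply: leq_trans (card_size _) _.
  by rewrite size_drop; lia.
have [symw adjw eqw] := sw.
have cutw x y : x \in [set v] -> y \notin [set v] -> w x y = 0.
  pose A := [set (v, y) | y in take 2 N].
  apply: (@stress_small_cut _ _ A p_gen V_gt2 sw) (x) (y).
    apply: leq_trans (leq_imset_card _ _) _; apply: leq_trans (card_size _) _.
    by rewrite size_take_min geq_minl.
  move=> a b; rewrite !inE => /eqP -> {a} bv vbA.
  case: (boolP (b \in N)) => [|bN].
    rewrite -[N](cat_take_drop 2) mem_cat => /orP[bN|bN].
      by case/negP: vbA; apply: imset_f.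
    by apply: Fw; rewrite inE imset_f ?orbT.
  move: bN; rewrite mem_enum inE negb_and => /orP[bW|/adjw //].
  by rewrite symw supw.
apply: detW => //; last by move=> x y xyF; apply: Fw; rewrite inE xyF.
move=> x y; rewrite !inE negb_and negbK => /orP[/eqP ->|]; last exact: supw.
have [->|yv] := eqVneq y v; first by rewrite adjw ?adj_irr.
by apply: cutw; rewrite inE.
Qed.

(** * The number of edges needed *)

Hypothesis adj_sym : symmetric adj.
Hypothesis adj_4 : valent 4 adj.

(** Edge-connectivity at least c of the subgraph induced on W. *)
Definition edge_connected (c : nat) (W : {set V}) : Prop :=
  forall X, X != set0 -> X \proper W -> (c <= edge_count adj X (W :\: X))%N.

(** In terms of the number m of edges induced on W the inequality is
    5 k <= 3 m - 4 |W| + 3; the complete graph on four vertices attains it. *)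
Definition sparse_bound (W : {set V}) : Prop :=
  exists2 k, determined W k & (10 * k + 8 * #|W| <= 3 * edge_count adj W W + 6)%N.

(** Induction step of the count, by repeatedly splitting U along cuts of size at
    most 2.  A single vertex has the surplus 3 d - 8, a piece to which the
    sparse bound applies has the surplus 3 c - 6 because at least c edges leave
    it inside W, and the minimum in the statement is subadditive in |U|. *)
Lemma determined_proper c d (W : {set V}) : (1 < c)%N -> (2 < d)%N ->
  edge_connected c W ->
  (forall x, x \in W -> (d <= edge_count adj [set x] W)%N) ->
  (forall U : {set V}, U \proper W -> (1 < #|U|)%N -> edge_connected 3 U ->
     (0 < edge_count adj U (~: U))%N -> sparse_bound U) ->
  forall U : {set V}, U != set0 -> U \proper W ->
  exists2 k, determined U k &
    (10 * k + 8 * #|U| + minn (3 * c - 6) ((3 * d - 8) * #|U|)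
       <= 3 * edge_count adj U W)%N.
Proof.
move=> c2 d3 connW degW IHW U; have [n] := ubnP #|U|.
elim: n U => // n IH U Un U0 UW.
have sUW := proper_sub UW.
have cutU := connW U U0 UW.
have [/cards1P[x Ux]|U1] := boolP (#|U| == 1%N).
  exists 0; first by rewrite Ux; exact: determined1.
  have := degW x; rewrite -sub1set -Ux sUW => /(_ isT).
  by rewrite Ux cards1; lia.
have cardU : (1 < #|U|)%N by move: U0 U1; rewrite -card_gt0; lia.
case: (boolP [exists X : {set V}, [&& X != set0, X \proper U
                     & (edge_count adj X (U :\: X) <= 2)%N]]).
  case/existsP => X /and3P[X0 XU cutX].
  have sXU := proper_sub XU.
  have dX : [disjoint X & U :\: X] by exact: disjointD.
  have cardX : (#|X| < #|U|)%N by exact: proper_card.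
  have Ueq : U = X :|: (U :\: X) by rewrite setUDK_sub.
  have cardD : #|U| = (#|X| + #|U :\: X|)%N by rewrite cardsDS // subnKC // subset_leq_card.
  have X1 : (0 < #|X|)%N by rewrite card_gt0.
  have [||i detX bX] := IH X _ X0; [lia | exact: proper_sub_trans XU sUW |].
  have [|||j detY bY] := IH (U :\: X).
  - lia.
  - by rewrite -card_gt0; lia.
  - by apply: sub_proper_trans UW; exact: subsetDl.
  exists (i + j)%N; first by rewrite Ueq; exact: determined_split.
  have -> : edge_count adj U W = (edge_count adj X W + edge_count adj (U :\: X) W)%N.
    by rewrite -(edge_countUl adj _ dX) -Ueq.
  (* minn a (b * (m + n)) <= minn a (b * m) + minn a (b * n) *)
  rewrite cardD mulnDr; nia.
rewrite negb_exists => /forallP conn3.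
have [||k detU bU] := IHW U UW cardU.
- move=> X X0 XU; have := conn3 X; rewrite X0 XU /= -ltnNge; lia.
- have sWU : W :\: U \subset ~: U by rewrite setDE subsetIr.
  by have := edge_count_subr adj_sym U sWU; lia.
exists k => //; rewrite (edge_count_splitr adj_sym _ sUW); lia.
Qed.

(** Since W has an edge to its complement and all degrees are 4, some v in W has
    degree at most 3 in W, hence exactly 3.  Deleting it costs one edge, and
    it has three neighbours, so W - v has at least three vertices and the surplus
    is 3. *)
Lemma three_edge_connected_bound (W : {set V}) : (1 < #|W|)%N ->
  edge_connected 3 W -> (0 < edge_count adj W (~: W))%N -> sparse_bound W.
Proof.
have [n] := ubnP #|W|; elim: n W => // n IH W Wn W1 connW cutW.
have degW x : x \in W -> (2 < edge_count adj [set x] W)%N.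
  move=> xW; apply: leq_trans (edge_count_subr adj_sym _ (subsetDl W [set x])).
  apply: connW; first by rewrite -card_gt0 cards1.
  by rewrite properEcard sub1set xW cards1.
have [v vW degv] : exists2 v, v \in W & edge_count adj [set v] W = 3.
  move: cutW; rewrite lt0n sum_nat_eq0 negb_forall => /existsP[v].
  rewrite negb_imply => /andP[vW cutv]; exists v => //.
  have := edge_count_all adj_4 [set v]; rewrite (edge_count_splitr adj_sym _ (subsetT W)) setTD.
  have := degW v vW; rewrite cards1 /edge_count !big_set1; move: cutv; lia.
have dv : [disjoint [set v] & W :\ v] by rewrite disjoints1 !inE eqxx.
have cardW : #|W| = #|W :\ v|.+1 by rewrite (cardsD1 v) vW.
have cardv : (2 < #|W :\ v|)%N.
  have degv' : edge_count adj [set v] (W :\ v) = 3.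
    by move: degv; rewrite -{1}(setD1K vW) (edge_countUr adj_sym) // edge_count1 // add0n.
  apply: (@leq_trans (edge_count adj [set v] (W :\ v))); first by rewrite degv'.
  rewrite /edge_count big_set1.
  by rewrite -sum1_card; apply: leq_sum => y _; case: adj.
have IHW (U : {set V}) : U \proper W -> (1 < #|U|)%N -> edge_connected 3 U ->
    (0 < edge_count adj U (~: U))%N -> sparse_bound U.
  by move=> UW; apply: IH; have := proper_card UW; lia.
have [||k detk bk] := @determined_proper 3 3 W isT isT connW degW IHW (W :\ v).
- by rewrite -card_gt0; lia.
- exact: properD1.
exists (k + 1)%N; first by apply: determined_vertex vW _ detk; rewrite degv.
have : edge_count adj W W = (3 + edge_count adj (W :\ v) W)%N.
  by rewrite -{1}(setD1K vW) edge_countUl // degv.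
lia.
Qed.

Hypothesis adj_conn : connected_graph adj.

Lemma determined_all : exists2 k, determined [set: V] k & (10 * k <= 4 * #|V| + 10)%N.
Proof.
have IH (U : {set V}) : U \proper [set: V] -> (1 < #|U|)%N -> edge_connected 3 U ->
    (0 < edge_count adj U (~: U))%N -> sparse_bound U.
  by move=> _; exact: three_edge_connected_bound.
have deg4 x : x \in [set: V] -> (4 <= edge_count adj [set x] [set: V])%N.
  by rewrite (edge_count_all adj_4) cards1.
have nontriv (A : {set V}) : A \proper [set: V] -> ~: A != set0.
  by rewrite properT; apply: contra => /eqP e; rewrite -(setCK A) e setC0.
case: (boolP [exists X : {set V}, [&& X != set0, X \proper [set: V]
                     & (edge_count adj X (~: X) <= 2)%N]]).
  case/existsP => X /and3P[X0 XT cutX].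
  have conn2 : edge_connected 2 [set: V].
    by move=> Y Y0 YT; rewrite setTD; apply: (cut_ge2 adj_sym adj_irr adj_4) => //; exact: nontriv.
  have dX : [disjoint X & ~: X] by rewrite -setI_eq0 setICr.
  have [//|//|i detX bX] := @determined_proper 2 4 _ isT isT conn2 deg4 IH X.
  have [||j detY bY] := @determined_proper 2 4 _ isT isT conn2 deg4 IH (~: X).
  - exact: nontriv.
  - by rewrite properT; apply: contra X0 => /eqP e; rewrite -(setCK X) e setCT.
  exists (i + j)%N; first by rewrite -(setUCr X); exact: determined_split.
  have := cardsC X; move: bX bY; rewrite !(edge_count_all adj_4); lia.
rewrite negb_exists => /forallP conn3.
have conn4 : edge_connected 4 [set: V].
  move=> Y Y0 YT; have := conn3 Y; have := cut_even adj_sym adj_irr adj_4 Y; rewrite setTD Y0 YT /=.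
  by case: edge_count => [|[|[|[|]]]].
have [v _] : exists v, v \in [set: V] by apply/card_gt0P; rewrite cardsT; lia.
have cardV : #|V| = #|[set: V] :\ v|.+1 by rewrite -cardsT (cardsD1 v) inE.
have [||k detk bk] := @determined_proper 4 4 _ isT isT conn4 deg4 IH ([set: V] :\ v).
- by rewrite -card_gt0; lia.
- by apply: properD1; rewrite inE.
exists (k + 2)%N.
  by apply: determined_vertex detk; rewrite ?inE // (edge_count_all adj_4) cards1.
move: bk; rewrite (edge_count_all adj_4); lia.
Qed.

End Stresses.

(** * The rank of the rigidity matrix *)

Section Rank.
Set Implicit Arguments.
Unset Strict Implicit.
Context {R : realType} {V : finType} (adj : rel V) (p : V -> 'rV[R]_2).
Hypothesis adj_sym : symmetric adj.
Hypothesis adj_irr : irreflexive adj.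

(** The coordinate of u at the edge E, extended by 0 to all vertex sets. *)
Definition edge_weight (u : 'rV[R]_(#|edges adj|)) (E : {set V}) : R :=
  \sum_(i | enum_val i == E) u 0 i.

Lemma edge_weight_val u i : edge_weight u (enum_val i) = u 0 i.
Proof.
rewrite /edge_weight (big_pred1 i) // => j.
by rewrite (inj_eq enum_val_inj).
Qed.

Definition stress_of (u : 'rV[R]_(#|edges adj|)) (x y : V) : R :=
  if adj x y then edge_weight u [set x; y] else 0.

Lemma stress_of_ker u : u *m rigidity_mx adj p = 0 -> stress adj p (stress_of u).
Proof.
move=> uM; split=> [x y|x y /negPf xy|v k]; rewrite /stress_of.
- by rewrite adj_sym setUC.
- by rewrite xy.
pose g (E : {set V}) := if v \in E then \sum_(z in E :\ v) (p v - p z) 0 k else 0.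
transitivity (\sum_(E in edges adj) edge_weight u E * g E); last first.
  move/rowP/(_ (enum_rank (v, k))): uM; rewrite !mxE => {2}<-.
  rewrite big_enum_val; apply: eq_bigr => i _.
  by rewrite edge_weight_val !mxE enum_rankK.
rewrite [RHS](bigID (fun E : {set V} => v \in E)) /= [X in _ + X]big1 ?addr0; last first.
  by move=> E /andP[_ /negPf vE]; rewrite /g vE mulr0.
rewrite [RHS](eq_bigl (mem [set [set v; y] | y in [set y | adj v y]])); last first.
  move=> E; apply/andP/imsetP => [[/edgesP[x [y [xy ->]]]]|[y]].
    rewrite !inE => /orP[]/eqP ->; first by exists y; rewrite ?inE.
    by exists x; rewrite ?inE 1?adj_sym // setUC.
  by rewrite inE => vy ->; rewrite mem_edges // !inE eqxx.
rewrite [RHS]big_imset /=; last first.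
  move=> y z; rewrite !inE => vy vz /setP/(_ y); rewrite !inE eqxx orbT.
  have -> : (y == v) = false by apply: contraTF vy => /eqP ->; rewrite adj_irr.
  by move/esym/eqP.
rewrite [RHS]big_mkcond; apply: eq_bigr => y _; rewrite inE.
case: ifP => vy; last by rewrite mul0r.
rewrite /g !inE eqxx (big_pred1 y) ?mxE // => z; rewrite !inE.
case: (eqVneq z v) => //= ->; apply/esym.
by apply: contraTF vy => /eqP <-; rewrite adj_irr.
Qed.

(** The coordinates at F are k linear functionals on the left kernel with no
    common zero but 0, so the kernel has dimension at most k. *)
Lemma rank_rigidity_mx k : determined adj p [set: V] k ->
  (#|edges adj| <= \rank (rigidity_mx adj p) + k)%N.
Proof.
case=> F Fk detV.
(* u *m L lists the weights given by u to the pairs in F. *)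
pose L : 'M[R]_(#|edges adj|, #|F|) :=
  \matrix_(i, j) (enum_val i == [set (enum_val j).1; (enum_val j).2])%:R.
pose K := kermx (rigidity_mx adj p).
have KL0 : (K :&: kermx L)%MS = 0.
  apply/eqP/rowV0P => u; rewrite sub_capmx => /andP[/sub_kermxP uM /sub_kermxP uL].
  have sw0 := detV _ (stress_of_ker uM).
  apply/rowP => i; rewrite mxE -edge_weight_val.
  have [x [y [xy ->]]] := edgesP (enum_valP i).
  have := sw0 _ _ x y; rewrite /stress_of xy; apply=> [a b|a b abF].
    by rewrite inE.
  case: ifP => // _.
  move/rowP/(_ (enum_rank_in abF (a, b))): uL; rewrite !mxE => <-.
  rewrite /edge_weight big_mkcond; apply: eq_bigr => j _.
  by rewrite mxE enum_rankK_in //=; case: eqP => _; rewrite ?mulr1 ?mulr0.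
have := mxrank_mul_ker K L; rewrite KL0 mxrank0 addn0 mxrank_ker => rKL.
by have := rank_leq_col (K *m L); rewrite rKL; lia.
Qed.

End Rank.

Theorem theorem1p2 (R : realType) (V : finType) (adj : rel V)
    (adj_sym : symmetric adj) (adj_irr : irreflexive adj)
    (adj_conn : connected_graph adj) (adj_4 : valent 4 adj)
    (p : V -> 'rV[R]_2) (p_gen : general_position p) :
  (\rank (rigidity_mx adj p))%:R >= 8 / 5 * #|V|%:R - 1 :> R.
Proof.
have [V0|[v _]] := set_0Vmem [set: V].
  have -> : #|V| = 0%N by rewrite -cardsT V0 cards0.
  by have := ler0n R (\rank (rigidity_mx adj p)); lra.
have V_gt2 : (2 < #|V|)%N.
  by have := max_card (mem [set y | adj v y]); rewrite adj_4; lia.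
have [k detV kV] := determined_all adj_irr p_gen V_gt2 adj_sym adj_4 adj_conn.
have rkV := rank_rigidity_mx adj_sym adj_irr detV.
have eV := card_edges adj_irr adj_4.
have : (8 * #|V| <= 5 * \rank (rigidity_mx adj p) + 5)%N by lia.
by rewrite -(ler_nat R) natrD !natrM; lra.
Qed.
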